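(* Let $E$ be a countably Dedekind complete Riesz space, let $V\subset E$ (with the order inherited from $E$), and let $(V,\mathbb T)$ with $\mathbb T=\{T_\sigma:\sigma\in\Sigma\}$ be a regular abstract dynamic program. Let $V$ be countably chain complete. If $(V,\mathbb T)$ is order continuous and asymptotically order contracting, then (i) the fundamental optimality properties hold for $(V,\mathbb T)$, and (ii) VFI, OPI and HPI all converge.
   Context: For elements $v\le w$ of a poset, $[v,w]=\{u:v\le u\le w\}$ is an order interval. A poset $V$ is countably chain complete if it is order bounded (i.e. $V$ itself is an order interval $[a,b]$ with $a,b\in V$) and every countable chain in $V$ has a supremum and an infimum in $V$. A poset is countably Dedekind complete if every order interval in it is countably chain complete. In a poset, write $v_n\uparrow v$ if $(v_n)$ is increasing with supremum $v$, and $v_n\downarrow v$ if it is decreasing with infimum $v$. A self-map $S$ on a poset $V$ is order continuous if $v_n\uparrow v$ in $V$ implies $Sv_n\uparrow Sv$. A sequence $(v_n)$ in $E$ order converges to $v\in E$, written $v_n\stackrel{o}{\to}v$, if there is a sequence $d_n\downarrow0$ in $E$ with $|v_n-v|\le d_n$ for all $n\in\mathbb N$. A self-map $S$ on $V\subset E$ is asymptotically order contracting on $V$ if $|S^nv-S^nw|\stackrel{o}{\to}0$ for any $v,w\in V$. $(V,\mathbb T)$ is order continuous (resp. asymptotically order contracting) if each $T_\sigma\in\mathbb T$ is order continuous (resp. asymptotically order contracting) on $V$. Abstract dynamic programs. An abstract dynamic program (ADP) is a pair $(V,\mathbb T)$ where $V=(V,\preceq)$ is a poset (here $\preceq$ is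 the order inherited from $E$) and $\mathbb T=\{T_\sigma:\sigma\in\Sigma\}$ is a nonempty family of order preserving self-maps on $V$; elements of $\Sigma$ are called policies. Given $v\in V$, $\sigma\in\Sigma$ is $v$-greedy if $T_\tau v\preceq T_\sigma v$ for all $\tau\in\Sigma$. The Bellman operator is $Tv:=\bigvee_\sigma T_\sigma v$ whenever the supremum exists; $v\in V$ solves the Bellman equation if $Tv$ exists and $Tv=v$. $(V,\mathbb T)$ is well-posed if each $T_\sigma$ has a unique fixed point $v_\sigma$ in $V$, and regular if a $v$-greedy policy exists for every $v\in V$. When $(V,\mathbb T)$ is well-posed, $V_\Sigma:=\{v_\sigma:\sigma\in\Sigma\}$; $\sigma$ is optimal if $v_\sigma$ is a greatest element of $V_\Sigma$; and the value function is $v^*:=\bigvee V_\Sigma$ whenever the supremum exists. Bellman's principle of optimality holds if $(V,\mathbb T)$ is well-posed and $\{\sigma\in\Sigma:\sigma\text{ is optimal}\}=\{\sigma\in\Sigma:\sigma\text{ is }v^*\text{-greedy}\}$ (both sets understood as empty if $v^*$ does not exist). The fundamental optimality properties hold if $(V,\mathbb T)$ is well-posed and regular and: (B1) at least one optimal policy exists; (B2) $v^*$ is the unique solution to the Bellman equation in $V$; (B3) Bellman's principle of optimality holds. Algorithms. Fix, for each $v\in V$, a choice of $v$-greedy policy $\sigma$. Set $Hv:=v_\sigma$ (Howard policy operator) and, for $m\in\mathbb N$, $m\ge1$, $W_mv:=T_\sigma^m v$ (optimistic policy operator), where $\sigma$ is the chosen $v$-greedy policy. Let $V_U=\{v\in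 V:v\preceq Tv\}$. VFI converges if $T^nv\uparrow v^*$ for all $v\in V_U$; OPI converges if $W_m^nv\uparrow v^*$ for all $v\in V_U$ (for each $m$); HPI converges if $H^nv\uparrow v^*$ for all $v\in V_U$. *)

(* Defs.v *)
From HB Require Import structures.
From mathcomp Require Import all_boot all_order all_algebra.
From mathcomp Require Import all_classical all_reals.

Set Implicit Arguments.
Unset Strict Implicit.
Unset Printing Implicit Defensive.

Import Order.TTheory GRing.Theory Num.Theory.

Local Open Scope classical_set_scope.
Local Open Scope ring_scope.

(* The lattice structure is given by the existence of binary suprema and infima,
   since [Order.Lattice] at [ring_display] cannot be joined with
   [GRing.Lmodule]: HB rejects the missing join with [Num.RealDomain]. *)
HB.mixin Record POrderedLmodule_isRiesz (R : realType) E
    of GRing.Lmodule R E & Num.POrderedZmodule E := {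
  riesz_leD2r : forall z x y : E, x <= y -> x + z <= y + z;
  riesz_scale_ge0 : forall (a : R) (x : E), 0 <= a -> 0 <= x -> 0 <= a *: x;
  riesz_has_sup : forall x y : E, supremums [set x; y] !=set0;
  riesz_has_inf : forall x y : E, infimums [set x; y] !=set0
}.

#[short(type="rieszType")]
HB.structure Definition Riesz (R : realType) :=
  { E of GRing.Lmodule R E & Num.POrderedZmodule E
       & POrderedLmodule_isRiesz R E }.

Definition riesz_abs (R : realType) (E : rieszType R) (x : E) : E :=
  supremum 0 [set x; - x].

(* A subset of a poset, seen as a type, carries the inherited order; suprema
   and infima in that type are those relative to the subset. *)
HB.instance Definition _ (T : choiceType) (A : set T) :=
  SubChoice.copy (set_type A) {x : T | x \in A}.
HB.instance Definition _ d (T : porderType d) (A : set T) :=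
  [SubChoice_isSubPOrder of set_type A by <: with d].

Section Posets.
Context d (V : porderType d).
Implicit Types (u : nat -> V) (v w : V).

Definition order_interval v w : set V := [set x | (v <= x <= w)%O].

Definition countably_chain_complete : Prop :=
  (exists a b : V, [set: V] = order_interval a b) /\
  forall C : set V, countable C -> total_on C (fun x y => (x <= y)%O) ->
    supremums C !=set0 /\ infimums C !=set0.

Definition increases_to u v : Prop :=
  {homo u : n m / (n <= m)%N >-> (n <= m)%O} /\ supremums (range u) v.

Definition decreases_to u v : Prop :=
  {homo u : n m / (n <= m)%N >-> (m <= n)%O} /\ infimums (range u) v.

Definition order_continuous (S : V -> V) : Prop :=
  forall u v, increases_to u v -> increases_to (S \o u) (S v).

End Posets.

Definition countably_dedekind_complete d (E : porderType d) : Prop :=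
  forall v w : E, (v <= w)%O -> countably_chain_complete (order_interval v w).

Section OrderConvergence.
Context (R : realType) (E : rieszType R).

Definition order_converges (u : nat -> E) (v : E) : Prop :=
  exists2 b : nat -> E, decreases_to b 0 &
    forall n, riesz_abs (u n - v) <= b n.

Definition asymptotically_order_contracting (V : set E) (S : V -> V) : Prop :=
  forall v w : V,
    order_converges
      (fun n => riesz_abs (\val (iter n S v) - \val (iter n S w))) 0.

End OrderConvergence.

Record adp d (V : porderType d) := ADP {
  policy : Type;
  policy_inhabited : inhabited policy;
  policy_op : policy -> V -> V;
  policy_op_homo : forall s : policy,
    {homo policy_op s : v w / (v <= w)%O}
}.

Section DynamicProgramming.
Context d (V : porderType d) (A : adp V).
Implicit Types (s : policy A) (v : V).

Definition greedy v s : Prop :=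
  forall t : policy A, (policy_op t v <= policy_op s v)%O.

Definition regular : Prop := forall v, exists s, greedy v s.

Definition well_posed : Prop := forall s, exists! v, policy_op s v = v.

Definition policy_image v : set V := range (fun s => policy_op s v).

Definition bellman_defined v : Prop := supremums (policy_image v) !=set0.

(* Meaningful only when [bellman_defined v]; otherwise it returns [v]. *)
Definition bellman v : V := supremum v (policy_image v).

Definition solves_bellman v : Prop := bellman_defined v /\ bellman v = v.

Definition upper_set : set V :=
  [set v | bellman_defined v /\ (v <= bellman v)%O].

Section WellPosed.
Hypothesis wp : well_posed.

Definition policy_value s : V := sval (cid (wp s)).

Definition policy_values : set V := range policy_value.

Definition optimal s : Prop := ubound policy_values (policy_value s).

Definition is_value_function v : Prop := supremums policy_values v.

(* Both sides are empty when the value function does not exist: the value of an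
   optimal policy, being a greatest element, is the supremum. *)
Definition principle_of_optimality : Prop :=
  [set s | optimal s] = [set s | exists2 v, is_value_function v & greedy v s].

Definition howard_op (g : V -> policy A) v : V := policy_value (g v).

End WellPosed.

Definition optimistic_op (g : V -> policy A) (m : nat) v : V :=
  iter m (policy_op (g v)) v.

Definition fundamental_optimality : Prop :=
  exists wp : well_posed,
    [/\ regular,
        exists s, optimal wp s,
        exists v, [/\ is_value_function wp v, solves_bellman v
                    & forall w, solves_bellman w -> w = v]
      & principle_of_optimality wp].

Definition iterates_converge (wp : well_posed) (F : V -> V) : Prop :=
  exists2 vstar, is_value_function wp vstar &
    forall v, upper_set v -> increases_to (fun n => iter n F v) vstar.

Definition vfi_converges : Prop :=
  exists wp : well_posed, iterates_converge wp bellman.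

Definition opi_converges (g : V -> policy A) : Prop :=
  exists wp : well_posed,
    forall m, (1 <= m)%N -> iterates_converge wp (optimistic_op g m).

Definition hpi_converges (g : V -> policy A) : Prop :=
  exists wp : well_posed, iterates_converge wp (howard_op wp g).

End DynamicProgramming.

(* Main.v *)
Require Import Defs.
From HB Require Import structures.
From mathcomp Require Import all_boot all_order all_algebra.
From mathcomp Require Import all_classical all_reals.

(** Asymptotic contraction is used only to see that each policy operator has at
    most one fixed point.  The rest is Kleene iteration: an order preserving,
    order continuous map [S] on a countably chain complete poset has iterates
    [S^n v] increasing to a fixed point of [S] as soon as [v <= S v].  By regularity [T v] is
    attained at a greedy policy, so [T] inherits order preservation and order
    continuity from the policy operators.  A fixed point of [T] is the value of
    any of its greedy policies and dominates every other policy value, so it is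
    unique and equals [v*].  HPI and OPI converge because on [V_U] their
    operators lie between [T] and [v*] and preserve [V_U]. *)

Set Implicit Arguments.
Unset Strict Implicit.
Unset Printing Implicit Defensive.

Import Order.TTheory GRing.Theory Num.Theory.

Local Open Scope classical_set_scope.
Local Open Scope order_scope.

(** * Increasing sequences and Kleene iteration in posets *)

Section PosetLemmas.
Context d (V : porderType d).
Implicit Types (u : nat -> V) (v w : V) (B : set V) (S : V -> V).

Lemma supremums_max B v : B v -> ubound B v -> supremums B v.
Proof. by move=> Bv Bub; split=> // w; apply. Qed.

(** On the empty set [supremum] returns its default [x0], hence the nonemptiness condition. *)
Lemma supremum_supremums x0 B v :
  B !=set0 -> supremums B v -> supremum x0 B = v.
Proof.
move=> /set0P/negPf B0 Bv; rewrite /supremum B0.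
by case: xgetP => [_ -> Bx|/(_ v)//]; exact: is_subset1_supremums Bx Bv.
Qed.

Lemma increases_to_ub u v n : increases_to u v -> u n <= v.
Proof. by case=> _ [ub _]; apply: ub; exists n. Qed.

Lemma increases_to_least u v w :
  increases_to u v -> (forall n, u n <= w) -> v <= w.
Proof. by case=> _ [_ lub] uw; apply: lub => _ [n _ <-]. Qed.

Lemma increases_toP u v : (forall n, u n <= u n.+1) -> (forall n, u n <= v) ->
  (forall w, (forall n, u n <= w) -> v <= w) -> increases_to u v.
Proof.
move=> incu ub lub; split.
  by apply: homo_leq => // x y z; exact: le_trans.
by split=> [_ [n _ <-]//|w wub]; apply: lub => n; apply: wub; exists n.
Qed.

Lemma increases_to_unique u v w : increases_to u v -> increases_to u w -> v = w.
Proof. by case=> _ uv [_ uw]; exact: is_subset1_supremums uv uw. Qed.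

Lemma increases_to_shift u v : increases_to u v -> increases_to (u \o succn) v.
Proof.
move=> uv; have [incu _] := uv; apply: increases_toP => [n|n|w uw].
- exact: incu.
- exact: increases_to_ub uv.
- by apply: (increases_to_least uv) => n; apply: le_trans (uw n); exact: incu.
Qed.

Lemma ccc_increases_to u : countably_chain_complete V ->
  (forall n, u n <= u n.+1) -> exists v, increases_to u v.
Proof.
case=> _ ccc incu.
have homu : {homo u : n m / (n <= m)%N >-> n <= m}.
  by apply: homo_leq => // x y z; exact: le_trans.
have [] := ccc (range u).
- exact: card_image_le.
- move=> _ _ [n _ <-] [m _ <-].
  by have [nm|/ltnW mn] := leqP n m; [left|right]; exact: homu.
- by case=> v uv _; exists v.
Qed.

(** A least element [a] satisfies [a <= S a] for every self-map [S], so Kleene iteration can always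
    start there. *)
Lemma ccc_bottom : countably_chain_complete V -> exists a, forall v, a <= v.
Proof.
move=> [[a [b Vab]] _]; exists a => v.
have : [set: V] v by [].
by rewrite Vab => /andP[].
Qed.

Lemma iter_homo S n : {homo S : v w / v <= w} ->
  {homo iter n S : v w / v <= w}.
Proof. by move=> homS v w vw; elim: n => //= n; exact: homS. Qed.

Lemma iter_incr S v n : {homo S : v w / v <= w} -> v <= S v ->
  iter n S v <= iter n.+1 S v.
Proof. by move=> homS vSv; rewrite iterSr; exact: iter_homo. Qed.

(** By continuity [S] sends the limit of the iterates to the limit of the shifted sequence, which is
    the same limit. *)
Lemma kleene_iteration S v : countably_chain_complete V ->
  {homo S : v w / v <= w} -> order_continuous S -> v <= S v ->
  exists2 w, S w = w & increases_to (fun n => iter n S v) w.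
Proof.
move=> ccc homS contS vSv.
have [w uw] := ccc_increases_to ccc (fun n => iter_incr n homS vSv).
exists w => //.
exact: increases_to_unique (contS _ _ uw) (increases_to_shift uw).
Qed.

End PosetLemmas.

(** * Absolute values and order limits in a Riesz space *)

Section RieszLemmas.
Context (R : realType) (E : rieszType R).
Implicit Types x y : E.
Local Open Scope ring_scope.

Lemma riesz_absP x : supremums [set x; - x] (riesz_abs x).
Proof.
have [y xy] := riesz_has_sup x (- x).
by rewrite /riesz_abs (supremum_supremums _ _ xy) //; exists x; left.
Qed.

Lemma riesz_ler_norm x : x <= riesz_abs x.
Proof. by have [ub _] := riesz_absP x; apply: ub; left. Qed.

Lemma riesz_lerN_norm x : - x <= riesz_abs x.
Proof. by have [ub _] := riesz_absP x; apply: ub; right. Qed.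

Lemma riesz_norm_le0 x : riesz_abs x <= 0 -> x = 0.
Proof.
move=> x0; apply/le_anti; rewrite (le_trans (riesz_ler_norm x) x0) /=.
(* Adding [x] to both sides of [- x <= 0] gives the remaining inequality [0 <= x]. *)
have := riesz_leD2r x _ _ (le_trans (riesz_lerN_norm x) x0).
by rewrite addNr add0r.
Qed.

(** The constant [riesz_abs (x - y)] is a lower bound of a sequence with infimum 0. *)
Lemma order_converges_cst x y : order_converges (fun=> x) y -> x = y.
Proof.
case=> b [_ [_ b0]] xb; apply/subr0_eq/riesz_norm_le0/b0 => _ [n _ <-].
exact: xb.
Qed.

(** Iterating [S] on fixed points makes the contracting sequence constant, so it equals its order
    limit 0. *)
Lemma contracting_fixed_unique (V : set E) (S : V -> V) (v w : V) :
  asymptotically_order_contracting S -> S v = v -> S w = w -> v = w.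
Proof.
move=> /(_ v w) + Sv Sw.
under eq_fun do rewrite !iter_fix //.
move/order_converges_cst => vw; apply/val_inj/subr0_eq/riesz_norm_le0.
by rewrite vw.
Qed.

End RieszLemmas.

(** * The Bellman operator of a regular program *)

Section AbstractDP.
Context d (V : porderType d) (A : adp V).
Implicit Types (s t : policy A) (v w : V) (g : V -> policy A).

Lemma greedy_supremums v s : greedy v s ->
  supremums (policy_image A v) (policy_op s v).
Proof. by move=> vs; apply: supremums_max => [|_ [t _ <-]//]; exists s. Qed.

Lemma bellman_greedy v s : greedy v s -> bellman A v = policy_op s v.
Proof.
move=> vs; apply: supremum_supremums (greedy_supremums vs).
by exists (policy_op s v), s.
Qed.

Hypothesis reg : regular A.

Lemma regular_bellman_defined v : bellman_defined A v.
Proof.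
by have [s /greedy_supremums vs] := reg v; exists (policy_op s v).
Qed.

Lemma policy_op_le_bellman s v : policy_op s v <= bellman A v.
Proof. by have [t vt] := reg v; rewrite (bellman_greedy vt); exact: vt. Qed.

Lemma bellman_homo : {homo bellman A : v w / v <= w}.
Proof.
move=> v w vw; have [s vs] := reg v; rewrite (bellman_greedy vs).
by apply: le_trans (policy_op_le_bellman s w); exact: policy_op_homo.
Qed.

Hypothesis cont : forall s, order_continuous (policy_op s).

Lemma bellman_order_continuous : order_continuous (bellman A).
Proof.
move=> u v uv; have [incu _] := uv; apply: increases_toP => /= [n|n|w Tuw].
- by apply/bellman_homo/incu.
- exact/bellman_homo/(increases_to_ub _ uv).
(* One policy greedy at the limit [v] suffices: its operator is continuous and lies below the
   Bellman operator along [u]. *)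
have [s vs] := reg v; rewrite (bellman_greedy vs).
apply: (increases_to_least (cont s uv)) => n /=.
exact: le_trans (policy_op_le_bellman s _) (Tuw n).
Qed.

Hypothesis ccc : countably_chain_complete V.

Hypothesis fixed_unique : forall s v w,
  policy_op s v = v -> policy_op s w = w -> v = w.

Lemma fixed_unique_well_posed : well_posed A.
Proof.
move=> s; have [a bot] := ccc_bottom ccc.
have [v Sv _] :=
  kleene_iteration ccc (@policy_op_homo _ _ A s) (@cont s) (bot _).
by exists v; split=> // w; exact: fixed_unique.
Qed.

(** * Policy values and fixed points of the Bellman operator *)

Section Value.
Variable wp : well_posed A.

Lemma policy_value_fixed s :
  policy_op s (policy_value wp s) = policy_value wp s.
Proof. by rewrite /policy_value; case: cid => v []. Qed.

Lemma policy_valueE s v : policy_op s v = v -> policy_value wp s = v.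
Proof. exact: fixed_unique (policy_value_fixed s). Qed.

Lemma le_policy_value s v : v <= policy_op s v -> v <= policy_value wp s.
Proof.
move=> vSv; have [w Sw vw] :=
  kleene_iteration ccc (@policy_op_homo _ _ A s) (@cont s) vSv.
by rewrite (policy_valueE Sw); exact: (increases_to_ub 0%N vw).
Qed.

(* Iterating from the bottom element avoids continuity along decreasing
   sequences. *)
Lemma policy_value_le s v : policy_op s v <= v -> policy_value wp s <= v.
Proof.
move=> Svv; have [a bot] := ccc_bottom ccc.
have [w Sw aw] :=
  kleene_iteration ccc (@policy_op_homo _ _ A s) (@cont s) (bot _).
rewrite (policy_valueE Sw); apply: (increases_to_least aw).
elim=> [|n IHn]; first exact: bot.
exact: le_trans (policy_op_homo s IHn) Svv.
Qed.

Lemma bellman_fixed_greedy v s :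
  bellman A v = v -> greedy v s -> policy_value wp s = v.
Proof. by move=> Tv vs; apply: policy_valueE; rewrite -(bellman_greedy vs). Qed.

(** A greedy policy attains [v], and any other policy [t] has [policy_op t v <= v], which bounds its
    value by [v]. *)
Lemma bellman_fixed_value v : bellman A v = v -> is_value_function wp v.
Proof.
move=> Tv; have [s vs] := reg v; apply: supremums_max => [|_ [t _ <-]].
  by exists s => //; exact: bellman_fixed_greedy.
by apply: policy_value_le; rewrite -{2}Tv; exact: policy_op_le_bellman.
Qed.

Lemma value_bellman_fixed :
  exists2 vstar, is_value_function wp vstar & bellman A vstar = vstar.
Proof.
have [a bot] := ccc_bottom ccc.
have [v Tv _] :=
  kleene_iteration ccc bellman_homo bellman_order_continuous (bot _).
by exists v => //; exact: bellman_fixed_value.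
Qed.

(** * Convergence of iterates to the value function *)

Section Iteration.
Variable vstar : V.
Hypothesis vstarP : is_value_function wp vstar.

Lemma policy_value_le_value s : policy_value wp s <= vstar.
Proof. by have [ub _] := vstarP; apply: ub; exists s. Qed.

Lemma bellman_fixedE v : bellman A v = v -> v = vstar.
Proof.
by move=> Tv; exact: is_subset1_supremums (bellman_fixed_value Tv) vstarP.
Qed.

Lemma bellman_iterates v : v <= bellman A v ->
  increases_to (fun n => iter n (bellman A) v) vstar.
Proof.
move=> vTv; have [w Tw vw] :=
  kleene_iteration ccc bellman_homo bellman_order_continuous vTv.
by rewrite -(bellman_fixedE Tw).
Qed.

(** [F] need not be order preserving: the induction compares iterates through monotonicity of the
    Bellman operator alone. *)
Lemma squeezed_iterates (F : V -> V) v :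
  (forall w, w <= bellman A w ->
    [/\ bellman A w <= F w, F w <= vstar & F w <= bellman A (F w)]) ->
  v <= bellman A v -> increases_to (fun n => iter n F v) vstar.
Proof.
move=> squeeze vTv.
have FU n : iter n F v <= bellman A (iter n F v).
  by elim: n => //= n /squeeze[].
have TF n : iter n (bellman A) v <= iter n F v.
  elim: n => //= n IHn; apply: le_trans (bellman_homo IHn) _.
  by have [] := squeeze _ (FU n).
have incF n : iter n F v <= iter n.+1 F v.
  by have [TF' _ _] := squeeze _ (FU n); exact: le_trans (FU n) TF'.
apply: increases_toP => // [n|w Fw].
  by apply: le_trans (incF n) _; have [] := squeeze _ (FU n).
apply: (increases_to_least (bellman_iterates vTv)) => n.
exact: le_trans (TF n) (Fw n).
Qed.

Lemma howard_squeeze g w : (forall v, greedy v (g v)) -> w <= bellman A w ->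
  [/\ bellman A w <= howard_op wp g w, howard_op wp g w <= vstar
    & howard_op wp g w <= bellman A (howard_op wp g w)].
Proof.
move=> gP; rewrite (bellman_greedy (gP w)) /howard_op => wSw; split.
- rewrite -[leRHS]policy_value_fixed; apply: policy_op_homo.
  exact: le_policy_value.
- exact: policy_value_le_value.
- rewrite -[leLHS]policy_value_fixed; exact: policy_op_le_bellman.
Qed.

Lemma optimistic_squeeze g m w : (forall v, greedy v (g v)) -> (1 <= m)%N ->
  w <= bellman A w ->
  [/\ bellman A w <= optimistic_op g m w, optimistic_op g m w <= vstar
    & optimistic_op g m w <= bellman A (optimistic_op g m w)].
Proof.
case: m => // m gP _; rewrite (bellman_greedy (gP w)) /optimistic_op => wSw.
set S := policy_op (g w) in wSw *.
have homS : {homo S : v w / v <= w} by exact: policy_op_homo.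
split.
- rewrite iterS; apply/homS; elim: m => //= m IHm.
  exact/(le_trans wSw)/homS.
(* From [w <= S w], [w] lies below the value of [g w], which every power of [S] fixes. *)
- apply: le_trans (policy_value_le_value (g w)).
  rewrite -[leRHS](iter_fix m.+1 (policy_value_fixed (g w))).
  exact/iter_homo/le_policy_value.
- by apply: le_trans (policy_op_le_bellman (g w) _); exact: iter_incr.
Qed.

End Iteration.

(** Either condition on [s] forces its policy value to be [vstar]. *)
Lemma optimal_iff_greedy vstar s : is_value_function wp vstar ->
  bellman A vstar = vstar -> optimal wp s <-> greedy vstar s.
Proof.
move=> vstarP Tvstar; split=> [opt t|vs].
  have sv : policy_value wp s = vstar.
    apply: is_subset1_supremums vstarP.
    by apply: supremums_max => //; exists s.
  apply: le_trans (policy_op_le_bellman t _) _.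
  by rewrite Tvstar -sv policy_value_fixed.
move=> _ [t _ <-]; rewrite (bellman_fixed_greedy Tvstar vs).
exact: policy_value_le_value.
Qed.

End Value.

(** * Optimality properties and convergence of the algorithms *)

Lemma adp_fundamental_optimality : fundamental_optimality A.
Proof.
pose wp := fixed_unique_well_posed; exists wp.
have [v vP Tv] := value_bellman_fixed wp.
split=> //.
- by have [s vs] := reg v; exists s; apply/(optimal_iff_greedy _ vP Tv).
- exists v; split=> // [|w [_ Tw]]; last exact: bellman_fixedE vP w Tw.
  by split=> //; exact: regular_bellman_defined.
- apply/seteqP; split=> s /=.
    by move=> /(optimal_iff_greedy _ vP Tv) vs; exists v.
  move=> [w wP]; rewrite (is_subset1_supremums wP vP) => vs.
  exact/(optimal_iff_greedy _ vP Tv).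
Qed.

Lemma adp_algorithms_converge g : (forall v, greedy v (g v)) ->
  [/\ vfi_converges A, opi_converges g & hpi_converges g].
Proof.
move=> gP; pose wp := fixed_unique_well_posed.
have [v vP Tv] := value_bellman_fixed wp.
split; exists wp.
- by exists v => // w [_]; exact: bellman_iterates.
- move=> m m1; exists v => // w [_]; apply: squeezed_iterates => // x.
  exact: optimistic_squeeze.
- exists v => // w [_]; apply: squeezed_iterates => // x.
  exact: howard_squeeze.
Qed.

End AbstractDP.

Theorem theorem5p2 (R : realType) (E : rieszType R) (V : set E) (A : adp V)
    (HE : countably_dedekind_complete E)
    (HA : regular A)
    (HV : countably_chain_complete V)
    (Hcont : forall s : policy A, order_continuous (policy_op s))
    (Hcontr : forall s : policy A,
       asymptotically_order_contracting (policy_op s)) :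
  fundamental_optimality A /\
  (forall g : V -> policy A, (forall v : V, greedy v (g v)) ->
     [/\ vfi_converges A, opi_converges g & hpi_converges g]).
Proof.
have uniq (s : policy A) (v w : V) :
    policy_op s v = v -> policy_op s w = w -> v = w.
  exact: contracting_fixed_unique (Hcontr s).
split; first exact: adp_fundamental_optimality.
by move=> g gP; exact: adp_algorithms_converge.
Qed.
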